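(* Let $\mathbf{B}\in\mathbb{C}^{n\times k}$ be the balanced Reed-Solomon encoding matrix and, for every $\mathcal{I}\subseteq\{1,\dots,n\}$ with $|\mathcal{I}|=f=n-s$, let $\mathbf{a}_{\mathcal{I}}\in\mathbb{C}^{f}$ be the corresponding decoding vector (both described in the context), which satisfy $\mathbf{a}_{\mathcal{I}}^T\mathbf{B}_{\mathcal{I}}=\mathbf{1}_{1\times k}$ for every such $\mathcal{I}$. Let $\mathbf{w}\in\mathbb{C}^{1\times k}$ be arbitrary and put $\tilde{\mathbf{B}}:=\mathbf{B}\cdot\mathrm{diag}(\mathbf{w})$. Then for every $\mathcal{I}\subseteq\{1,\dots,n\}$ with $|\mathcal{I}|=f$, $$\mathbf{a}_{\mathcal{I}}^T\tilde{\mathbf{B}}_{\mathcal{I}}=\mathbf{w}.$$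
   Context: Setting: $n$ workers, $k$ data parts, at most $s$ stragglers, $f:=n-s$. Each part is assigned to exactly $d=s+1$ workers and each worker receives exactly $w$ parts, so $n w=k d$ (here the integer $w$ is unrelated to the vector $\mathbf{w}$). For a matrix $M$ with $n$ rows and an index set $\mathcal{I}\subseteq\{1,\dots,n\}$, $M_{\mathcal{I}}$ is the submatrix of the rows indexed by $\mathcal{I}$; $\mathbf{1}_{1\times k}$ is the all-ones row vector; $\mathrm{diag}(\mathbf{w})$ is the $k\times k$ diagonal matrix with diagonal $\mathbf{w}$. Encoding matrix: let $\beta_1,\dots,\beta_n$ be the $n$ distinct elements of $U_n=\{a\in\mathbb{C}:a^n=1\}$, with $\beta_i$ attached to worker $i$. For each part $j\in\{1,\dots,k\}$ let $p_j\in\mathbb{C}[x]$ be the polynomial of degree $n-d=f-1$ whose roots are exactly the $\beta_i$ for those workers $i$ that are not assigned part $j$, normalized to have constant term $1$. The encoding matrix is $\mathbf{B}_{ij}=p_j(\beta_i)$. Equivalently $\mathbf{B}=\mathbf{G}\mathbf{T}$, where $\mathbf{G}\in\mathbb{C}^{n\times f}$ is the Vandermonde matrix $\mathbf{G}_{il}=\beta_i^{\,l-1}$ and $\mathbf{T}\in\mathbb{C}^{f\times k}$ has as its $j$-th column the coefficients of $p_j$ in order of increasing degree. Decoding vector: for $|\mathcal{I}|=f$ the square Vandermonde matrix $\mathbf{G}_{\mathcal{I}}$ is invertible, and $\mathbf{a}_{\mathcal{I}}^T$ is the first row of $\mathbf{G}_{\mathcal{I}}^{-1}$. *)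

(* Defs.v *)
From mathcomp Require Import all_boot all_order all_algebra.

Set Implicit Arguments.
Unset Strict Implicit.
Unset Printing Implicit Defensive.

Import GRing.Theory.
Local Open Scope ring_scope.

(* [A i] is the set of data parts held by worker [i]. *)
Definition balanced_assignment (n k d r : nat) (A : 'I_n -> {set 'I_k}) : Prop :=
  (forall j : 'I_k, #|[set i : 'I_n | j \in A i]| = d) /\
  (forall i : 'I_n, #|A i| = r).

Definition enumerates_unity_roots (F : fieldType) (n : nat)
    (beta : 'I_n -> F) : Prop :=
  injective beta /\ (forall z : F, z ^+ n = 1 <-> exists i, beta i = z).

Section ReedSolomon.
Variables (F : fieldType) (n : nat) (beta : 'I_n -> F).

Section Encoding.
Variables (k : nat) (A : 'I_n -> {set 'I_k}).

Definition vanishing_poly (j : 'I_k) : {poly F} :=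
  \prod_(i < n | j \notin A i) ('X - (beta i)%:P).

(* The constant term is nonzero, since roots of unity are; see [rs_polyP]. *)
Definition rs_poly (j : 'I_k) : {poly F} :=
  ((vanishing_poly j)`_0)^-1 *: vanishing_poly j.

Definition rs_encoding : 'M[F]_(n, k) := \matrix_(i, j) (rs_poly j).[beta i].

End Encoding.

(* The rows of [M] indexed by [I], in increasing order of index.  The proof of
   [#|I| = f] makes the number of rows syntactically [f]. *)
Definition select_rows (m f : nat) (I : {set 'I_n}) (hI : #|I| = f)
    (M : 'M[F]_(n, m)) : 'M[F]_(f, m) :=
  rowsub (fun l : 'I_f => enum_val (cast_ord (esym hI) l)) M.

(* This is the transpose of the library's [Vandermonde]: nodes index rows. *)
Definition rs_vandermonde (f : nat) : 'M[F]_(n, f) :=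
  \matrix_(i, l) beta i ^+ l.

(* The row vector a_I^T. *)
Definition rs_decoding (f : nat) (f_gt0 : (0 < f)%N) (I : {set 'I_n})
    (hI : #|I| = f) : 'rV[F]_f :=
  row (Ordinal f_gt0) (invmx (select_rows hI (rs_vandermonde f))).

End ReedSolomon.

(* [rs_poly] is the only polynomial of degree n - d with constant term 1 whose
   roots are exactly the nodes of the workers that do not hold part [j]. *)
Lemma rs_polyP (F : fieldType) (n k d r : nat) (beta : 'I_n -> F)
    (A : 'I_n -> {set 'I_k}) (j : 'I_k) (p : {poly F}) :
  enumerates_unity_roots beta -> balanced_assignment d r A ->
  p = rs_poly beta A j <->
  [/\ size p = (n - d).+1,
      forall x, root p x <-> exists2 i, j \notin A i & x = beta i
    & p`_0 = 1].
Proof.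
case=> beta_inj betaP [hd _].
pose s := [seq beta i | i <- enum [pred i | j \notin A i]].
have qE : vanishing_poly beta A j = \prod_(z <- s) ('X - z%:P).
  by rewrite /vanishing_poly /s big_map big_enum.
have s_uniq : uniq s by rewrite map_inj_uniq ?enum_uniq.
have memsP x : x \in s <-> exists2 i, j \notin A i & x = beta i.
  split=> [/mapP[i] | [i hi ->]].
    by rewrite mem_enum inE => hi ->; exists i.
  by apply/mapP; exists i; rewrite ?mem_enum.
have size_s : size s = (n - d)%N.
  rewrite size_map -cardE -(hd j) cardsE -[X in (X - _)%N](card_ord n).
  by rewrite -(cardC [pred i | j \in A i]) addKn.
have size_q : size (vanishing_poly beta A j) = (n - d).+1.
  by rewrite qE size_prod_XsubC size_s.
have root_q x : root (vanishing_poly beta A j) x = (x \in s).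
  by rewrite qE root_prod_XsubC.
have q0_neq0 : (vanishing_poly beta A j)`_0 != 0.
  rewrite -horner_coef0; apply/negP; rewrite -/(root _ _) root_q.
  move=> /memsP[i _ b0].
  have /betaP : exists i', beta i' = beta i by exists i.
  rewrite -b0 expr0n; case: (n) i {b0} => [[]//|m] _ /eqP.
  by rewrite eq_sym oner_eq0.
have c_neq0 : ((vanishing_poly beta A j)`_0)^-1 != 0 by rewrite invr_eq0.
split=> [-> | [size_p root_p p0]].
  split; first by rewrite size_scale.
    by move=> x; rewrite rootZ // root_q.
  by rewrite coefZ mulVf.
have q_dvd_p : vanishing_poly beta A j %| p.
  rewrite qE; apply: uniq_roots_dvdp; last by rewrite uniq_rootsE.
  by apply/allP => x /memsP/root_p.
have /eqpP[[a b] /= /andP[a0 b0] Eq] : vanishing_poly beta A j %= p.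
  by rewrite -dvdp_size_eqp // size_q size_p.
have pE : p = (b^-1 * a) *: vanishing_poly beta A j.
  by rewrite -scalerA Eq scalerA mulVf // scale1r.
have /esym : p`_0 = (b^-1 * a) * (vanishing_poly beta A j)`_0.
  by rewrite {1}pE coefZ.
rewrite p0 => /(canRL (mulfK q0_neq0)); rewrite mul1r => c_eq.
by rewrite pE c_eq.
Qed.

(* Main.v *)
(** With [T] the matrix of coefficients of the polynomials [p_j], the encoding
    matrix is [G *m T], so [a_I^T] applied to its rows in [I] is the first row
    of [G_I^-1 *m G_I *m T = T].  That row lists the constant terms of the
    [p_j], all equal to 1, and [diag w] turns it into [w]. *)

Require Import Defs.
From mathcomp Require Import all_boot all_order all_algebra.
From mathcomp Require Import reals.
From mathcomp.real_closed Require Import complex.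

Set Implicit Arguments.
Unset Strict Implicit.
Unset Printing Implicit Defensive.

Import GRing.Theory.
Local Open Scope ring_scope.

Lemma select_rows_mul (F : fieldType) (n m p f : nat) (I : {set 'I_n})
    (hI : #|I| = f) (M : 'M[F]_(n, m)) (N : 'M[F]_(m, p)) :
  select_rows hI (M *m N) = select_rows hI M *m N.
Proof. by rewrite /select_rows mul_rowsub_mx. Qed.

(** The determinant is the product of the differences of the nodes selected by [I], and these are
    pairwise distinct. *)
Lemma select_rows_vandermonde_unit (F : fieldType) (n f : nat)
    (beta : 'I_n -> F) (I : {set 'I_n}) (hI : #|I| = f) :
  injective beta -> select_rows hI (rs_vandermonde beta f) \in unitmx.
Proof.
move=> beta_inj.
pose node := \row_(l < f) beta (enum_val (cast_ord (esym hI) l)).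
have -> : select_rows hI (rs_vandermonde beta f) = (Vandermonde f node)^T.
  by apply/matrixP => l m; rewrite !mxE.
rewrite unitmx_tr unitmxE det_Vandermonde unitfE.
apply/prodf_neq0 => i _; apply/prodf_neq0 => j lt_ij.
rewrite !mxE subr_eq0; apply/eqP => /beta_inj/enum_val_inj/cast_ord_inj eq_ji.
by rewrite eq_ji ltnn in lt_ij.
Qed.

(** This is [T] when [p] is the family of the p_j. Coefficients from degree [f] on are cut off,
    hence the size bounds below. *)
Definition coef_mx (F : fieldType) (f k : nat) (p : 'I_k -> {poly F}) :
  'M[F]_(f, k) := \matrix_(l, j) (p j)`_l.

Lemma mul_rs_vandermonde_coef (F : fieldType) (n f k : nat) (beta : 'I_n -> F)
    (p : 'I_k -> {poly F}) :
  (forall j, size (p j) <= f)%N ->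
  rs_vandermonde beta f *m coef_mx f p = \matrix_(i, j) (p j).[beta i].
Proof.
move=> size_p; apply/matrixP => i j; rewrite !mxE (horner_coef_wide _ (size_p j)).
by apply: eq_bigr => l _; rewrite !mxE mulrC.
Qed.

(** Interpolation: [f] values at distinct nodes determine a polynomial of size at most [f], and the
    decoding vector reads off its value at 0. *)
Lemma rs_decoding_mul_coef (F : fieldType) (n f k : nat) (f_gt0 : (0 < f)%N)
    (beta : 'I_n -> F) (I : {set 'I_n}) (hI : #|I| = f)
    (p : 'I_k -> {poly F}) :
  injective beta -> (forall j, size (p j) <= f)%N ->
  rs_decoding beta f_gt0 hI *m select_rows hI (\matrix_(i, j) (p j).[beta i])
    = \row_j (p j)`_0.
Proof.
move=> beta_inj size_p.
rewrite -(mul_rs_vandermonde_coef beta size_p) select_rows_mul /rs_decoding.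
rewrite -row_mul mulKmx; last exact: select_rows_vandermonde_unit.
by apply/rowP => j; rewrite !mxE.
Qed.

Theorem theorem4p1 (R : realType) (n k s r : nat) (f_gt0 : (0 < n - s)%N)
    (A : 'I_n -> {set 'I_k}) (hA : balanced_assignment s.+1 r A)
    (beta : 'I_n -> R[i]) (hbeta : enumerates_unity_roots beta)
    (w : 'rV[R[i]]_k)
    (I : {set 'I_n}) (hI : #|I| = (n - s)%N) :
  rs_decoding beta f_gt0 hI
    *m select_rows hI (rs_encoding beta A *m diag_mx w) = w.
Proof.
have rs_polyE j : [/\ size (rs_poly beta A j) = (n - s)%N
    & (rs_poly beta A j)`_0 = 1].
  have [+ _] := rs_polyP j (rs_poly beta A j) hbeta hA.
  (* The size comes as [(n - s.+1).+1]; it equals [n - s] because [f_gt0] gives [s < n], so that the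
     subtraction does not truncate. *)
  by case=> // -> _ ->; rewrite subnSK // -subn_gt0.
(* Row selection commutes with the right factor [diag_mx w], so decoding acts on the unweighted
   encoding alone. *)
rewrite select_rows_mul mulmxA rs_decoding_mul_coef; first last.
- by move=> j; have [-> _] := rs_polyE j.
- by case: hbeta.
apply/rowP => j; rewrite mul_mx_diag !mxE.
by have [_ ->] := rs_polyE j; rewrite mul1r.
Qed.
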